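(* A point $\bar x\in\mathbb{R}^n$ feasible for (MPCC) is AW-stationary if and only if there exists a sequence $\{(x^k,\lambda^k)\}_{k=1}^\infty\subset\mathbb{R}^{n}\times\mathbb{R}^\ell$, where $\lambda^k=(\lambda_g^k,\lambda_h^k,\lambda_G^k,\lambda_H^k)$, such that the following conditions hold: - $x^k\to\bar x$; - $\nabla_x\mathcal L^{\mathrm{cc}}(x^k,\lambda^k)\to0$; - $\{\lambda_g^k\}_{k=1}^\infty\subset\mathbb{R}^m_+$ and $\min\{-g_i(x^k),(\lambda_g^k)_i\}\to0$ for all $i\in[m]$; - $\min\{G_i(x^k),|(\lambda_G^k)_i|\}\to0$ and $\min\{H_i(x^k),|(\lambda_H^k)_i|\}\to0$ for all $i\in[q]$.
   Context: (MPCC): $\min_x f(x)$ s.t. $g(x)\le0$, $h(x)=0$, $0\le G(x)\perp H(x)\ge0$, with continuously differentiable $f\colon\mathbb{R}^n\to\mathbb{R}$, $g\colon\mathbb{R}^n\to\mathbb{R}^m$, $h\colon\mathbb{R}^n\to\mathbb{R}^p$, $G,H\colon\mathbb{R}^n\to\mathbb{R}^q$, $q\ge1$. Set $\ell=m+p+2q$, $[r]=\{1,\dots,r\}$, and, for $\lambda=(\lambda_g,\lambda_h,\lambda_G,\lambda_H)\in\mathbb{R}^\ell$, $$\mathcal L^{\mathrm{cc}}(x,\lambda)=f(x)+\lambda_g^\top g(x)+\lambda_h^\top h(x)-\lambda_G^\top G(x)-\lambda_H^\top H(x).$$ A feasible point $\bar x$ is AW-stationary if there exists a sequence $\{(x^k,\lambda^k,\delta^k,\varepsilon^k)\}_{k=1}^\infty\subset\mathbb{R}^n\times\mathbb{R}^\ell\times\mathbb{R}^\ell\times\mathbb{R}^n$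 with $\lambda^k=(\lambda_g^k,\lambda_h^k,\lambda_G^k,\lambda_H^k)$, $\delta^k=(\delta_g^k,\delta_h^k,\delta_G^k,\delta_H^k)$ such that $(x^k,\delta^k,\varepsilon^k)\to(\bar x,0,0)$ and, for all $k\in\mathbb{N}$: - $\varepsilon^k=\nabla_x\mathcal L^{\mathrm{cc}}(x^k,\lambda^k)$; - $(\lambda_g^k)_i\ge0$, $g_i(x^k)\le(\delta_g^k)_i$, $(\lambda_g^k)_i(g_i(x^k)-(\delta_g^k)_i)=0$ for all $i\in[m]$; - $h(x^k)=\delta_h^k$; - $G_i(x^k)\ge-(\delta_G^k)_i$, $(\lambda_G^k)_i(G_i(x^k)+(\delta_G^k)_i)=0$ for all $i\in[q]$; - $H_i(x^k)\ge-(\delta_H^k)_i$, $(\lambda_H^k)_i(H_i(x^k)+(\delta_H^k)_i)=0$ for all $i\in[q]$; - $(G_i(x^k)+(\delta_G^k)_i)(H_i(x^k)+(\delta_H^k)_i)=0$ for all $i\in[q]$. *)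

(* Defs.v *)
From mathcomp Require Import all_boot all_order all_algebra.
From mathcomp Require Import all_classical all_reals all_analysis.

Set Implicit Arguments.
Unset Strict Implicit.
Unset Printing Implicit Defensive.

Import Order.TTheory GRing.Theory Num.Theory.
Import numFieldNormedType.Exports.

Local Open Scope classical_set_scope.
Local Open Scope ring_scope.

(* R^n is 'rV[R]_n; its topology is that of the maximum norm. *)

Definition dotv (R : realType) (n : nat) (u v : 'rV[R]_n) : R :=
  \sum_(i < n) u 0 i * v 0 i.

Definition gradient (R : realType) (n : nat) (f : 'rV[R]_n -> R)
    (x : 'rV[R]_n) : 'rV[R]_n :=
  \row_(j < n) 'D_(delta_mx 0 j) f x.

Definition C1_scalar (R : realType) (n : nat) (f : 'rV[R]_n -> R) : Prop :=
  (forall x, differentiable f x) /\ continuous (gradient f).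

Definition C1_vector (R : realType) (n r : nat)
    (F : 'rV[R]_n -> 'rV[R]_r) : Prop :=
  (forall x, differentiable F x) /\ continuous (jacobian F).

Record mpcc (R : realType) (n m p q : nat) := MPCC {
  mpcc_f : 'rV[R]_n -> R ;
  mpcc_g : 'rV[R]_n -> 'rV[R]_m ;
  mpcc_h : 'rV[R]_n -> 'rV[R]_p ;
  mpcc_G : 'rV[R]_n -> 'rV[R]_q ;
  mpcc_H : 'rV[R]_n -> 'rV[R]_q ;
  mpcc_f_C1 : C1_scalar mpcc_f ;
  mpcc_g_C1 : C1_vector mpcc_g ;
  mpcc_h_C1 : C1_vector mpcc_h ;
  mpcc_G_C1 : C1_vector mpcc_G ;
  mpcc_H_C1 : C1_vector mpcc_H
}.

Definition feasible (R : realType) (n m p q : nat) (P : mpcc R n m p q)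
    (x : 'rV[R]_n) : Prop :=
  [/\ forall i, mpcc_g P x 0 i <= 0,
      mpcc_h P x = 0,
      forall i, 0 <= mpcc_G P x 0 i,
      forall i, 0 <= mpcc_H P x 0 i
    & dotv (mpcc_G P x) (mpcc_H P x) = 0].

(* The blocks of lambda = (lambda_g, lambda_h, lambda_G, lambda_H) in
   R^l, where l = m + p + 2q is written m + p + (q + q). *)
Definition blk_g (R : realType) (m p q : nat)
    (lam : 'rV[R]_(m + p + (q + q))) : 'rV[R]_m := lsubmx (lsubmx lam).
Definition blk_h (R : realType) (m p q : nat)
    (lam : 'rV[R]_(m + p + (q + q))) : 'rV[R]_p := rsubmx (lsubmx lam).
Definition blk_G (R : realType) (m p q : nat)
    (lam : 'rV[R]_(m + p + (q + q))) : 'rV[R]_q := lsubmx (rsubmx lam).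
Definition blk_H (R : realType) (m p q : nat)
    (lam : 'rV[R]_(m + p + (q + q))) : 'rV[R]_q := rsubmx (rsubmx lam).

Definition Lcc (R : realType) (n m p q : nat) (P : mpcc R n m p q)
    (x : 'rV[R]_n) (lam : 'rV[R]_(m + p + (q + q))) : R :=
  mpcc_f P x + dotv (blk_g lam) (mpcc_g P x) + dotv (blk_h lam) (mpcc_h P x)
  - dotv (blk_G lam) (mpcc_G P x) - dotv (blk_H lam) (mpcc_H P x).

Definition grad_x_Lcc (R : realType) (n m p q : nat) (P : mpcc R n m p q)
    (x : 'rV[R]_n) (lam : 'rV[R]_(m + p + (q + q))) : 'rV[R]_n :=
  gradient (fun y => Lcc P y lam) x.

Definition AW_stationary (R : realType) (n m p q : nat) (P : mpcc R n m p q)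
    (xbar : 'rV[R]_n) : Prop :=
  feasible P xbar /\
  exists (x : nat -> 'rV[R]_n) (lam delta : nat -> 'rV[R]_(m + p + (q + q)))
         (eps : nat -> 'rV[R]_n),
    ((fun k => (x k, delta k, eps k)) @ \oo -->
      (xbar, 0 : 'rV[R]_(m + p + (q + q)), 0 : 'rV[R]_n)) /\
    forall k,
      [/\ eps k = grad_x_Lcc P (x k) (lam k),
          forall i, [/\ 0 <= blk_g (lam k) 0 i,
            mpcc_g P (x k) 0 i <= blk_g (delta k) 0 i
            & blk_g (lam k) 0 i
                * (mpcc_g P (x k) 0 i - blk_g (delta k) 0 i) = 0],
          mpcc_h P (x k) = blk_h (delta k)
        & forall i,
          [/\ mpcc_G P (x k) 0 i >= - blk_G (delta k) 0 i,
              blk_G (lam k) 0 i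
                * (mpcc_G P (x k) 0 i + blk_G (delta k) 0 i) = 0,
              mpcc_H P (x k) 0 i >= - blk_H (delta k) 0 i,
              blk_H (lam k) 0 i
                * (mpcc_H P (x k) 0 i + blk_H (delta k) 0 i) = 0
            & (mpcc_G P (x k) 0 i + blk_G (delta k) 0 i)
                * (mpcc_H P (x k) 0 i + blk_H (delta k) 0 i) = 0]].

(* Main.v *)
Require Import Defs.
From mathcomp Require Import all_boot all_order all_algebra.
From mathcomp Require Import all_classical all_reals all_analysis.
From mathcomp Require Import ring lra.

Import Order.TTheory GRing.Theory Num.Theory.
Import numFieldNormedType.Exports.

Local Open Scope classical_set_scope.
Local Open Scope ring_scope.

(** Each inequality constraint is read as [a >= 0] with a multiplier of
magnitude [l >= 0], where [a] is [- g_i], [G_i] or [H_i].  The claim then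
compares two ways of saying that complementarity holds asymptotically:
exactly, but for a constraint relaxed by a vanishing [d], or approximately,
in the sense that [min(a, l)] tends to 0.

From the relaxed to the approximate form, the bound [|min(a, l)| <= |d|]
([norm_min_complementary]) suffices, and the sequence of points and
multipliers is kept unchanged.

In the other direction the points are kept but the multipliers have to change,
since a constraint that is inactive at the limit may carry a small nonzero
multiplier along the sequence, and no vanishing relaxation makes it
complementary.  Such multipliers are replaced by 0 ([truncated_mult]).  They
tend to 0, because [a] stays away from 0 while [min(a, l)] vanishes
([cvg_truncated_mult]), and the gradients that they multiply converge by
continuity of the Jacobians, so the gradient of the Lagrangian still tends
to 0 ([cvg_grad_x_Lcc]).  For the relaxation, a constraint that is active at
the limit is shifted so as to hold with equality at every point of the
sequence, which is a vanishing shift by continuity and allows an arbitrary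
multiplier; an inactive one is shifted just enough to hold ([slack]).  At the
limit point, feasibility makes [G_i] or [H_i] vanish for every [i], hence one
of the two relaxed constraints is an equality, which is the relaxed
complementarity of the pair. *)

(** * Exact and asymptotic complementarity of two scalars *)

Section ScalarComplementarity.
Context {R : realType}.
Implicit Types (a b l d : R) (u w : nat -> R).

(** If [l = 0], then [min(a, 0)] lies between [- |d|] and [0]; otherwise
[a = - d], and the minimum of [- d] and a nonnegative number is at most [|d|]
in magnitude. *)
Lemma norm_min_complementary a l d :
  0 <= l -> - d <= a -> l * (a + d) = 0 -> `|Num.min a l| <= `|d|.
Proof.
move=> l_ge0 da /eqP; rewrite mulf_eq0 => /orP[/eqP l0|].
  rewrite l0; case: (leP a 0) => a0; last by rewrite normr0.
  by rewrite ler0_norm// (le_trans _ (ler_norm d))// lerNl.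
rewrite addr_eq0 => /eqP aE; case: (leP a l) => al; first by rewrite aE normrN.
by rewrite ger0_norm// (le_trans (ltW al))// aE -(normrN d) ler_norm.
Qed.

(** [b] is the value of the constraint at the limit point and [a] its value at
the current iterate.  The test on [b] rather than on [a] fixes, once for the
whole sequence, which constraints are treated as active. *)
Definition slack b a : R := if b == 0 then - a else Num.max (- a) 0.

Definition truncated_mult b l : R := if b == 0 then l else 0.

Lemma slack_ge b a : - slack b a <= a.
Proof.
rewrite /slack; case: ifP => _; first by rewrite opprK.
by rewrite lerNl le_max lexx.
Qed.

Lemma slack_active b a : b = 0 -> a + slack b a = 0.
Proof. by move=> b0; rewrite /slack b0 eqxx subrr. Qed.

Lemma truncated_mult_slack b a l : truncated_mult b l * (a + slack b a) = 0.
Proof.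
rewrite /truncated_mult; case: eqP => [b0|_]; last by rewrite mul0r.
by rewrite slack_active// mulr0.
Qed.

Lemma truncated_mult_ge0 b l : 0 <= l -> 0 <= truncated_mult b l.
Proof. by rewrite /truncated_mult; case: ifP. Qed.

(** If [b = 0] the slack is [- u k], which tends to [- b = 0]; if [b > 0] the
constraint holds along the tail of the sequence and the slack is 0 there. *)
Lemma cvg_slack b u : 0 <= b -> u @ \oo --> b ->
  (fun k => slack b (u k)) @ \oo --> (0 : R).
Proof.
move=> b_ge0 ub; rewrite /slack; case: eqP => [b0|/eqP b_neq0].
  by rewrite -oppr0 -b0; exact: cvgN.
have b_gt0 : 0 < b by rewrite lt_def b_neq0.
apply: cvg_near_cst; near=> k; apply/max_idPr.
by rewrite oppr_le0 ltW//; near: k; exact: cvgr_gt ub _ b_gt0.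
Unshelve. all: by end_near. Qed.

(** If [b > 0], eventually [u k > b / 2] while the minimum is below [b / 2], so
the minimum is [`|w k|] itself; if [b = 0], nothing is truncated. *)
Lemma cvg_truncated_mult b u w : 0 <= b -> u @ \oo --> b ->
  (fun k => Num.min (u k) `|w k|) @ \oo --> (0 : R) ->
  (fun k => truncated_mult b (w k) - w k) @ \oo --> (0 : R).
Proof.
move=> b_ge0 ub min0; rewrite /truncated_mult; case: eqP => [b0|/eqP b_neq0].
  by under eq_fun do rewrite subrr; exact: cvg_cst.
have b_gt0 : 0 < b by rewrite lt_def b_neq0.
apply/norm_cvg0P; apply: (cvg_trans _ min0); apply: near_eq_cvg.
have b2_gt0 : 0 < b / 2 by rewrite divr_gt0.
near=> k.
have uk : b / 2 < u k by near: k; apply: (cvgr_gt _ ub); lra.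
have : Num.min (u k) `|w k| < b / 2
  by near: k; exact: (cvgr_lt _ min0 _ b2_gt0).
by rewrite sub0r normrN; case: (leP (u k)) => //; lra.
Unshelve. all: by end_near. Qed.

Lemma cvg_min_complementary u w (d : nat -> R) :
  d @ \oo --> (0 : R) -> (forall k, 0 <= w k) -> (forall k, - d k <= u k) ->
  (forall k, w k * (u k + d k) = 0) ->
  (fun k => Num.min (u k) (w k)) @ \oo --> (0 : R).
Proof.
move=> d0 w_ge0 ud wud; apply/norm_cvg0P; apply: squeeze_cvgr (cvg_cst 0) _.
  near=> k; rewrite normr_ge0/=; exact: norm_min_complementary (wud k).
by rewrite -[0](@normr0 _ R); exact: cvg_norm.
Unshelve. all: by end_near. Qed.
End ScalarComplementarity.

(** * Convergence and derivatives of row vectors *)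

Section RowVectors.
Context {R : realType}.

Lemma cvg_components {U V : topologicalType} {u : nat -> U} {v : nat -> V}
    {a : U} {b : V} :
  (fun k => (u k, v k)) @ \oo --> (a, b) -> u @ \oo --> a /\ v @ \oo --> b.
Proof.
move=> uvab; split.
  exact: (cvg_comp (fun k => (u k, v k)) fst uvab cvg_fst).
exact: (cvg_comp (fun k => (u k, v k)) snd uvab cvg_snd).
Qed.

Lemma cvg_rowP n (u : nat -> 'rV[R]_n) (l : 'rV[R]_n) :
  u @ \oo --> l <-> forall i, (fun k => u k 0 i) @ \oo --> l 0 i.
Proof.
split=> [ul i|ul].
  exact: continuous_cvg (@coord_continuous R 1 n 0 i l) ul.
apply/cvgrPdist_le => /= e e0; near=> k.
rewrite [leLHS]/Num.Def.normr/= mx_normrE (bigmax_le _ (ltW e0))//= => -[i j] _.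
rewrite !mxE/= (ord1 i); move: j; near: k; apply: filter_forall => j.
exact: ((cvgrPdist_le _ _).1 (ul j) e e0).
Unshelve. all: by end_near. Qed.

(** A vanishing factor against a convergent, hence bounded, one.  In the use
below [u] is a change of multipliers and [w] collects the derivatives of a
block of constraints in one coordinate direction. *)
Lemma cvg_dotv0 n (u w : nat -> 'rV[R]_n) (l : 'rV[R]_n) :
  u @ \oo --> (0 : 'rV[R]_n) -> w @ \oo --> l ->
  (fun k => dotv (u k) (w k)) @ \oo --> (0 : R).
Proof.
move=> /cvg_rowP u0 /cvg_rowP wl.
rewrite (_ : 0 = \sum_(i < n) 0 * l 0 i); last first.
  by rewrite big1// => i; rewrite mul0r.
apply: cvg_big => [|i _]; first exact: add_continuous.
by apply: cvgM; [have := u0 i; rewrite mxE|].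
Qed.

Lemma row_funE n (f : 'I_n -> R) i : (\row_j f j) 0 i = f i.
Proof. by rewrite mxE. Qed.

Lemma row_subE n (f : 'I_n -> R) (v : 'rV[R]_n) i :
  (\row_j f j - v) 0 i = f i - v 0 i.
Proof. by rewrite !mxE. Qed.

Lemma dotvBl n (u v w : 'rV[R]_n) : dotv (u - v) w = dotv u w - dotv v w.
Proof.
by rewrite /dotv -sumrB; apply: eq_bigr => i _; rewrite !mxE mulrBl.
Qed.

Lemma dotv_ge0_eq0 {n} {u v : 'rV[R]_n} :
  (forall i, 0 <= u 0 i) -> (forall i, 0 <= v 0 i) -> dotv u v = 0 ->
  forall i, u 0 i * v 0 i = 0.
Proof.
move=> u0 v0 /eqP; rewrite psumr_eq0 => [|i _]; last exact: mulr_ge0.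
by move=> /allP uv0 i; apply/eqP/uv0; rewrite mem_index_enum.
Qed.

Lemma is_derive_dotv {n r} {F : 'rV[R]_n -> 'rV[R]_r} (w : 'rV[R]_r)
    {x : 'rV[R]_n} (j : 'I_n) :
  differentiable F x ->
  is_derive x (delta_mx 0 j) (fun y => dotv w (F y))
    (dotv w (row j (jacobian F x))).
Proof.
move=> dF; have dFv : derivable F x (delta_mx 0 j) by exact: diff_derivable.
have /derivable_mxP dFi := dFv.
rewrite rowE -deriveEjacobian//.
rewrite (_ : (fun y => _) =
  \sum_(i < r) (w 0 i *: (fun y => F y 0 i))); last first.
  by apply/funext => y; rewrite fct_sumE.
apply: is_derive_eq.
  apply: is_derive_sum => i; apply: is_deriveZ.
  exact/derivableP/dFi.
apply: eq_bigr => i _.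
by rewrite derive_mx ?mxE.
Qed.

Lemma cvg_row_mx {n r} {u : nat -> 'rV[R]_n} {v : nat -> 'rV[R]_r}
    {a : 'rV[R]_n} {b : 'rV[R]_r} :
  u @ \oo --> a -> v @ \oo --> b ->
  (fun k => row_mx (u k) (v k)) @ \oo --> row_mx a b.
Proof.
move=> /cvg_rowP ua /cvg_rowP vb; apply/cvg_rowP => i.
under eq_fun do rewrite mxE; rewrite mxE.
by case: splitP => l _; [exact: ua|exact: vb].
Qed.

Lemma cvg_row_jacobian {n r} {F : 'rV[R]_n -> 'rV[R]_r} {x : nat -> 'rV[R]_n}
    {l : 'rV[R]_n} (j : 'I_n) :
  C1_vector F -> x @ \oo --> l ->
  (fun k => row j (jacobian F (x k))) @ \oo --> row j (jacobian F l).
Proof.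
move=> [_ dFc] xl; apply/cvg_rowP => i.
under eq_fun do rewrite mxE; rewrite mxE.
apply: (continuous_cvg _ (@coord_continuous R n r j i (jacobian F l))).
exact: continuous_cvg (dFc l) xl.
Qed.

Lemma cvg_C1_vector {n r} {F : 'rV[R]_n -> 'rV[R]_r} {x : nat -> 'rV[R]_n}
    {l : 'rV[R]_n} :
  C1_vector F -> x @ \oo --> l ->
  forall i, (fun k => F (x k) 0 i) @ \oo --> F l 0 i.
Proof.
move=> [dF _] xl; apply/cvg_rowP.
exact: continuous_cvg (differentiable_continuous (dF l)) xl.
Qed.
End RowVectors.

(** * The gradient of the MPCC-Lagrangian *)

Lemma gradientE (R : realType) n (f : 'rV[R]_n -> R) (x : 'rV[R]_n) j :
  gradient f x 0 j = 'D_(delta_mx 0 j) f x.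
Proof. by rewrite mxE. Qed.

Section LagrangianGradient.
Context {R : realType} {n m p q : nat} (P : mpcc R n m p q).
Implicit Types (x : 'rV[R]_n) (lam mu : 'rV[R]_(m + p + (q + q))).

(** The gradient is affine in the multipliers, with entries of the Jacobians as
coefficients; a vanishing change of the multipliers thus has a vanishing effect
as long as the Jacobians stay bounded. *)
Lemma grad_x_LccE x lam j :
  grad_x_Lcc P x lam 0 j = gradient (mpcc_f P) x 0 j
    + dotv (blk_g lam) (row j (jacobian (mpcc_g P) x))
    + dotv (blk_h lam) (row j (jacobian (mpcc_h P) x))
    - dotv (blk_G lam) (row j (jacobian (mpcc_G P) x))
    - dotv (blk_H lam) (row j (jacobian (mpcc_H P) x)).
Proof.
rewrite /grad_x_Lcc !gradientE /Lcc.
have df : derivable (mpcc_f P) x (delta_mx 0 j).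
  by apply: diff_derivable; exact: (mpcc_f_C1 P).1.
have dg := is_derive_dotv (blk_g lam) j ((mpcc_g_C1 P).1 x).
have dh := is_derive_dotv (blk_h lam) j ((mpcc_h_C1 P).1 x).
have dG := is_derive_dotv (blk_G lam) j ((mpcc_G_C1 P).1 x).
have dH := is_derive_dotv (blk_H lam) j ((mpcc_H_C1 P).1 x).
by have /@derive_val-> := is_deriveB (is_deriveB (is_deriveD
  (is_deriveD (derivableP df) dg) dh) dG) dH.
Qed.

Lemma grad_x_LccB x lam mu j :
  grad_x_Lcc P x mu 0 j = grad_x_Lcc P x lam 0 j
    + (dotv (blk_g mu) (row j (jacobian (mpcc_g P) x))
       - dotv (blk_g lam) (row j (jacobian (mpcc_g P) x)))
    + (dotv (blk_h mu) (row j (jacobian (mpcc_h P) x))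
       - dotv (blk_h lam) (row j (jacobian (mpcc_h P) x)))
    - (dotv (blk_G mu) (row j (jacobian (mpcc_G P) x))
       - dotv (blk_G lam) (row j (jacobian (mpcc_G P) x)))
    - (dotv (blk_H mu) (row j (jacobian (mpcc_H P) x))
       - dotv (blk_H lam) (row j (jacobian (mpcc_H P) x))).
Proof.
have shift (a b c d e b' c' d' e' : R) :
  a + b' + c' - d' - e' = a + b + c - d - e
    + (b' - b) + (c' - c) - (d' - d) - (e' - e) by ring.
rewrite !grad_x_LccE; exact: shift.
Qed.

(** Both sequences of multipliers may diverge, but their difference vanishes and
is paired with Jacobians that converge along [x]. *)
Lemma cvg_grad_x_Lcc {x : nat -> 'rV[R]_n} {xbar : 'rV[R]_n}
    {lam mu : nat -> 'rV[R]_(m + p + (q + q))} :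
  x @ \oo --> xbar ->
  (fun k => grad_x_Lcc P (x k) (lam k)) @ \oo --> (0 : 'rV[R]_n) ->
  (fun k => mu k - lam k) @ \oo --> (0 : 'rV[R]_(m + p + (q + q))) ->
  (fun k => grad_x_Lcc P (x k) (mu k)) @ \oo --> (0 : 'rV[R]_n).
Proof.
move=> xbarP /cvg_rowP grad0 /cvg_rowP mulam0; apply/cvg_rowP => j.
(* The four blocks are treated alike: each one reads off the coordinates
   selected by [s]. *)
have blk0 r (blk : 'rV[R]_(m + p + (q + q)) -> 'rV[R]_r)
    (s : 'I_r -> 'I_(m + p + (q + q))) (F : 'rV[R]_n -> 'rV[R]_r) :
    (forall lam i, blk lam 0 i = lam 0 (s i)) -> C1_vector F ->
    (fun k => dotv (blk (mu k)) (row j (jacobian F (x k)))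
            - dotv (blk (lam k)) (row j (jacobian F (x k)))) @ \oo --> (0 : R).
  move=> blkE FC1; under eq_fun do rewrite -dotvBl.
  apply: cvg_dotv0 (cvg_row_jacobian j FC1 xbarP); apply/cvg_rowP => i.
  under eq_fun do rewrite !mxE !blkE.
  by have := mulam0 (s i); under eq_fun do rewrite !mxE; rewrite !mxE.
have gE lam' i : blk_g lam' 0 i = lam' 0 (lshift _ (lshift _ i)) :> R
  by rewrite !mxE.
have hE lam' i : blk_h lam' 0 i = lam' 0 (lshift _ (rshift _ i)) :> R
  by rewrite !mxE.
have GE lam' i : blk_G lam' 0 i = lam' 0 (rshift _ (lshift _ i)) :> R
  by rewrite !mxE.
have HE lam' i : blk_H lam' 0 i = lam' 0 (rshift _ (rshift _ i)) :> R
  by rewrite !mxE.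
have dg := blk0 _ _ _ _ gE (mpcc_g_C1 P).
have dh := blk0 _ _ _ _ hE (mpcc_h_C1 P).
have dG := blk0 _ _ _ _ GE (mpcc_G_C1 P).
have dH := blk0 _ _ _ _ HE (mpcc_H_C1 P).
under eq_fun => k do rewrite (grad_x_LccB _ (lam k)).
rewrite -[_ 0 j]addr0 -[_ + 0]addr0 -[_ + 0 + 0]subr0 -[_ - 0]subr0.
exact: cvgB (cvgB (cvgD (cvgD (grad0 j) dg) dh) dG) dH.
Qed.
End LagrangianGradient.

(** * Multipliers assembled from their blocks *)

Section Blocks.
Context {R : realType} {m p q : nat}.
Implicit Types (g : 'rV[R]_m) (h : 'rV[R]_p) (G H : 'rV[R]_q).

Definition of_blocks g h G H : 'rV[R]_(m + p + (q + q)) :=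
  row_mx (row_mx g h) (row_mx G H).

Lemma of_blocksK lam :
  of_blocks (blk_g lam) (blk_h lam) (blk_G lam) (blk_H lam) = lam.
Proof. by rewrite /of_blocks !hsubmxK. Qed.

Lemma blk_g_of_blocks g h G H : blk_g (of_blocks g h G H) = g.
Proof. by rewrite /blk_g !row_mxKl. Qed.

Lemma blk_h_of_blocks g h G H : blk_h (of_blocks g h G H) = h.
Proof. by rewrite /blk_h row_mxKl row_mxKr. Qed.

Lemma blk_G_of_blocks g h G H : blk_G (of_blocks g h G H) = G.
Proof. by rewrite /blk_G row_mxKr row_mxKl. Qed.

Lemma blk_H_of_blocks g h G H : blk_H (of_blocks g h G H) = H.
Proof. by rewrite /blk_H !row_mxKr. Qed.

Definition of_blocksE :=
  (blk_g_of_blocks, blk_h_of_blocks, blk_G_of_blocks, blk_H_of_blocks).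

Lemma of_blocksB g g' h h' G G' H H' :
  of_blocks g h G H - of_blocks g' h' G' H' =
  of_blocks (g - g') (h - h') (G - G') (H - H').
Proof. by rewrite /of_blocks !(opp_row_mx, add_row_mx). Qed.

Lemma cvg_of_blocks0 {g : nat -> 'rV[R]_m} {h : nat -> 'rV[R]_p}
    {G H : nat -> 'rV[R]_q} :
  (forall i, (fun k => g k 0 i) @ \oo --> (0 : R)) ->
  (forall i, (fun k => h k 0 i) @ \oo --> (0 : R)) ->
  (forall i, (fun k => G k 0 i) @ \oo --> (0 : R)) ->
  (forall i, (fun k => H k 0 i) @ \oo --> (0 : R)) ->
  (fun k => of_blocks (g k) (h k) (G k) (H k)) @ \oo -->
    (0 : 'rV[R]_(m + p + (q + q))).
Proof.
have row0 r (u : nat -> 'rV[R]_r) :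
    (forall i, (fun k => u k 0 i) @ \oo --> (0 : R)) ->
    u @ \oo --> (0 : 'rV[R]_r).
  by move=> u0; apply/cvg_rowP => i; rewrite mxE.
move=> /row0 g0 /row0 h0 /row0 G0 /row0 H0.
rewrite -[0]row_mx0 -[X in row_mx X _]row_mx0 -[X in row_mx _ X]row_mx0.
exact: cvg_row_mx (cvg_row_mx g0 h0) (cvg_row_mx G0 H0).
Qed.
End Blocks.

(** * The characterization of AW-stationarity *)

Theorem lemma5p4 (R : realType) (n m p q : nat) (q_ge1 : (1 <= q)%N)
    (P : mpcc R n m p q) (xbar : 'rV[R]_n) (xbar_feasible : feasible P xbar) :
  AW_stationary P xbar <->
  exists (x : nat -> 'rV[R]_n) (lam : nat -> 'rV[R]_(m + p + (q + q))),
    [/\ x @ \oo --> xbar,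
        (fun k => grad_x_Lcc P (x k) (lam k)) @ \oo --> (0 : 'rV[R]_n),
        (forall k i, 0 <= blk_g (lam k) 0 i) /\
        (forall i, (fun k => Num.min (- mpcc_g P (x k) 0 i)
                                     (blk_g (lam k) 0 i)) @ \oo --> (0 : R))
      & forall i,
        ((fun k => Num.min (mpcc_G P (x k) 0 i)
                           `|blk_G (lam k) 0 i|) @ \oo --> (0 : R)) /\
        ((fun k => Num.min (mpcc_H P (x k) 0 i)
                           `|blk_H (lam k) 0 i|) @ \oo --> (0 : R))].
Proof.
split=> [[_ [x [lam [delta [eps [xdeps0 aw]]]]]]|].
  have [/cvg_components[xbarP delta0] eps0] := cvg_components xdeps0.
  have delta0i i : (fun k => delta k 0 i) @ \oo --> (0 : R).
    by have /cvg_rowP/(_ i) := delta0; rewrite mxE.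
  exists x, lam; split=> //.
  - by rewrite (_ : (fun k => _) = eps)//; apply/funext => k; have [->] := aw k.
  - split=> [k i|i]; first by have [_ /(_ i)[]] := aw k.
    apply: (@cvg_min_complementary _ _ _ (fun k => blk_g (delta k) 0 i)).
    + under eq_fun do rewrite !mxE; exact: delta0i.
    + by move=> k; have [_ /(_ i)[]] := aw k.
    + by move=> k; rewrite lerN2; have [_ /(_ i)[]] := aw k.
    + move=> k; have [_ /(_ i)[_ _ lam0] _ _] := aw k.
      by rewrite addrC -opprB mulrN lam0 oppr0.
  move=> i; split.
    apply: (@cvg_min_complementary _ _ _ (fun k => blk_G (delta k) 0 i)) => //.
    + under eq_fun do rewrite !mxE; exact: delta0i.
    + by move=> k; have [_ _ _ /(_ i)[]] := aw k.
    + move=> k; have [_ _ _ /(_ i)[_ lam0 _ _ _]] := aw k.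
      by apply/eqP; rewrite mulf_eq0 normr_eq0 -mulf_eq0 lam0.
  apply: (@cvg_min_complementary _ _ _ (fun k => blk_H (delta k) 0 i)) => //.
  + under eq_fun do rewrite !mxE; exact: delta0i.
  + by move=> k; have [_ _ _ /(_ i)[]] := aw k.
  + move=> k; have [_ _ _ /(_ i)[_ _ _ lam0 _]] := aw k.
    by apply/eqP; rewrite mulf_eq0 normr_eq0 -mulf_eq0 lam0.
move=> [x [lam [xbarP grad0 [lamg_ge0 ming0] minGH0]]].
have [gle0 h0 G_ge0 H_ge0 GH0] := xbar_feasible.
have GHi0 := dotv_ge0_eq0 G_ge0 H_ge0 GH0.
have g_cvg i := cvg_C1_vector (mpcc_g_C1 P) xbarP i.
have h_cvg i := cvg_C1_vector (mpcc_h_C1 P) xbarP i.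
have G_cvg i := cvg_C1_vector (mpcc_G_C1 P) xbarP i.
have H_cvg i := cvg_C1_vector (mpcc_H_C1 P) xbarP i.
have Ng_ge0 i : 0 <= - mpcc_g P xbar 0 i by rewrite oppr_ge0.
have Ng_cvg i : (fun k => - mpcc_g P (x k) 0 i) @ \oo --> - mpcc_g P xbar 0 i.
  exact: cvgN.
(* The equality constraints need no truncation and are relaxed by their own
   value. *)
pose mu k : 'rV[R]_(m + p + (q + q)) := of_blocks
  (\row_i truncated_mult (- mpcc_g P xbar 0 i) (blk_g (lam k) 0 i))
  (blk_h (lam k))
  (\row_i truncated_mult (mpcc_G P xbar 0 i) (blk_G (lam k) 0 i))
  (\row_i truncated_mult (mpcc_H P xbar 0 i) (blk_H (lam k) 0 i)).
pose delta k : 'rV[R]_(m + p + (q + q)) := of_blocks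
  (\row_i slack (- mpcc_g P xbar 0 i) (- mpcc_g P (x k) 0 i))
  (mpcc_h P (x k))
  (\row_i slack (mpcc_G P xbar 0 i) (mpcc_G P (x k) 0 i))
  (\row_i slack (mpcc_H P xbar 0 i) (mpcc_H P (x k) 0 i)).
have mulam0 : (fun k => mu k - lam k) @ \oo --> (0 : 'rV[R]_(m + p + (q + q))).
  rewrite (_ : (fun k => _) = fun k => mu k - of_blocks (blk_g (lam k))
    (blk_h (lam k)) (blk_G (lam k)) (blk_H (lam k))); last first.
    by apply/funext => k; rewrite of_blocksK.
  under eq_fun do rewrite /mu of_blocksB subrr.
  apply: cvg_of_blocks0 => i.
  - under eq_fun do rewrite row_subE.
    apply: cvg_truncated_mult (Ng_ge0 i) (Ng_cvg i) _.
    by under eq_fun do rewrite ger0_norm//; exact: ming0.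
  - by under eq_fun do rewrite mxE; exact: cvg_cst.
  - under eq_fun do rewrite row_subE.
    exact: cvg_truncated_mult (G_ge0 i) (G_cvg i) (minGH0 i).1.
  - under eq_fun do rewrite row_subE.
    exact: cvg_truncated_mult (H_ge0 i) (H_cvg i) (minGH0 i).2.
have delta0 : delta @ \oo --> (0 : 'rV[R]_(m + p + (q + q))).
  apply: cvg_of_blocks0 => i; last 2 first.
  - by under eq_fun do rewrite mxE; exact: cvg_slack.
  - by under eq_fun do rewrite mxE; exact: cvg_slack.
  - by under eq_fun do rewrite mxE; exact: cvg_slack (Ng_cvg i).
  - by have := h_cvg i; rewrite h0 mxE.
split=> //; exists x, mu, delta, (fun k => grad_x_Lcc P (x k) (mu k)).
split.
  have gradmu0 := cvg_grad_x_Lcc P xbarP grad0 mulam0.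
  exact: (cvg_pair (cvg_pair xbarP delta0) gradmu0).
move=> k; rewrite !of_blocksE; split=> // i; rewrite !row_funE.
  split; first exact: truncated_mult_ge0 (lamg_ge0 k i).
    by rewrite -lerN2 slack_ge.
  rewrite -[_ - slack _ _]opprK opprB addrC.
  by rewrite mulrN truncated_mult_slack oppr0.
split; rewrite ?slack_ge ?truncated_mult_slack//.
(* One of the pair is active at [xbar], so its relaxed value is 0. *)
have /eqP := GHi0 i; rewrite mulf_eq0 => /orP[/eqP|/eqP] /slack_active ->.
  by rewrite mul0r.
by rewrite mulr0.
Qed.
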